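(* Let $(\mathcal{C},\mathrm{C},\mathrm{W})$ be a Waldhausen category whose weak equivalence classes of objects form a set, and let $0$ be its zero object. Let $\mathrm{K}_0(\mathcal{C})$ be the Grothendieck heap of $\mathcal{C}$ (viewing $\mathcal{C}$ as an unpointed Waldhausen category), and let $\mathrm{K}_0(\mathcal{C})_c$ be the classical Grothendieck group of $\mathcal{C}$. Then the retract $(\mathrm{K}_0(\mathcal{C}),+_{\overline{0}})$ of the Grothendieck heap along $\overline{0}$, i.e. the group with the operation $\overline{X}+_{\overline{0}}\overline{Y}=[\overline{X},\overline{0},\overline{Y}]$, recovers the classical Grothendieck group: the assignment $\overline{X}\mapsto\overline{X}_c$ on generators ($X$ an object of $\mathcal{C}$) induces a well-defined isomorphism of groups $$(\mathrm{K}_0(\mathcal{C}),+_{\overline{0}})\;\cong\;\mathrm{K}_0(\mathcal{C})_c .$$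
   Context: **Heaps.** A heap is a set $H$ with a ternary operation $(x,y,z)\mapsto[x,y,z]$ such that $[x,x,y]=y=[y,x,x]$ and $[x,y,[x',y',z']]=[[x,y,x'],y',z']$. It is abelian if $[x,y,z]=[z,y,x]$ for all $x,y,z$. A morphism of heaps is a map $f$ with $f[x,y,z]=[fx,fy,fz]$. For $e\in H$, the retract of $H$ along $e$ is the group $(H,+_e)$ with underlying set $H$ and operation $x+_e y:=[x,e,y]$. An abelian heap given by generators and relations is the quotient of the free abelian heap on the generators by the congruence generated by the relations. **Unpointed Waldhausen categories.** An unpointed Waldhausen category is a triple $(\mathcal{C},\mathrm{C},\mathrm{W})$ consisting of a category $\mathcal{C}$, a subcategory $\mathrm{C}\subset\mathcal{C}$ of cofibrations (written $\rightarrowtail$) and a class $\mathrm{W}$ of morphisms of $\mathcal{C}$ called weak equivalences, such that: - isomorphisms are cofibrations; - if $Y\rightarrowtail Z$ is a cofibration and $Y\to X$ is any morphism, then the pushout $X\sqcup_Y Z$ exists and $X\rightarrowtail X\sqcup_Y Z$ is a cofibration; - isomorphisms are weak equivalences; - weak equivalences are closed under composition; - (gluing) given morphisms $f:Y\to X$, $f':Y'\to X'$, cofibrations $c:Y\rightarrowtail Z$, $c':Y'\rightarrowtail Z'$ and weak equivalences $h:X\to X'$, $w:Y\to Y'$, $s:Z\to Z'$ with $hf=f'w$ and $sc=c'w$, the induced morphism $X\sqcup_Y Z\to X'\sqcup_{Y'}Z'$ is a weak equivalence. A Waldhausen category is an unpointed Waldhausen category that moreover has a zero object $0$ such that $0\rightarrowtail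 X$ is a cofibration for every object $X$. **Weak equivalence classes.** These are the classes of objects for the equivalence relation generated by the existence of a weak equivalence between two objects; they are assumed to form a set. **Grothendieck heap.** For an unpointed Waldhausen category $\mathcal{C}$, $\mathrm{K}_0(\mathcal{C})$ is the abelian heap generated by the weak equivalence classes $\overline{X}$ of objects, subject to the relations $[\overline{X},\overline{Y},\overline{Z}]=\overline{X\sqcup_Y Z}$ for every pushout of a diagram $X\leftarrow Y\to Z$ in which $Y\to Z$ or $Y\to X$ is a cofibration. **Classical Grothendieck group.** In a Waldhausen category, a cofiber sequence $X\rightarrowtail Y\to Y/X$ consists of a cofibration $X\rightarrowtail Y$ and its pushout $Y\to Y/X:=0\sqcup_X Y$ along $X\to 0$. The classical Grothendieck group $\mathrm{K}_0(\mathcal{C})_c$ is the abelian group generated by the weak equivalence classes $\overline{X}_c$ of objects, subject to the relations $\overline{X}_c+\overline{Y/X}_c=\overline{Y}_c$ for every cofiber sequence $X\rightarrowtail Y\to Y/X$. *)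

(* Defs.v *)
From HB Require Import structures.
From mathcomp Require Import all_boot all_algebra.
From mathcomp.classical Require Import boolp.
From mathcomp.multinomials Require Import freeg.
From Stdlib Require Import Relation_Operators.

Set Implicit Arguments.
Unset Strict Implicit.
Unset Printing Implicit Defensive.

Import GRing.Theory.
Local Open Scope ring_scope.
Local Open Scope quotient_scope.

HB.mixin Record isHeap H of Choice H := {
  hbr : H -> H -> H -> H;
  hbrKl : forall x y, hbr x x y = y;
  hbrKr : forall x y, hbr y x x = y;
  hbrA : forall x y x' y' z', hbr x y (hbr x' y' z') = hbr (hbr x y x') y' z'
}.

#[short(type="heapType")]
HB.structure Definition Heap := {H of isHeap H & Choice H}.

HB.mixin Record Heap_isAbelian H of Heap H := {
  hbrC : forall x y z : H, hbr x y z = hbr z y x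
}.

#[short(type="abHeapType")]
HB.structure Definition AbHeap := {H of Heap_isAbelian H & Heap H}.

(* The alias [retract e] of [H] carries the group structure (H, +_e), as a
   [zmodType] since [H] is abelian. *)
Definition retract (H : abHeapType) (e : H) : Type := H.

Section Retract.
Variables (H : abHeapType) (e : H).

Definition retract_add (x y : H) : H := hbr x e y.
Definition retract_opp (x : H) : H := hbr e x e.

Fact retract_addA : associative retract_add.
Proof. by move=> x y z; rewrite /retract_add hbrA. Qed.

Fact retract_addC : commutative retract_add.
Proof. by move=> x y; exact: hbrC. Qed.

Fact retract_add0 : left_id e retract_add.
Proof. by move=> x; exact: hbrKl. Qed.

Fact retract_addN : left_inverse e retract_opp retract_add.
Proof.
by move=> x; rewrite /retract_add /retract_opp -hbrA hbrKl hbrKr.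
Qed.

HB.instance Definition _ := Choice.copy (retract e) H.
HB.instance Definition _ := GRing.isZmodule.Build (retract e)
  retract_addA retract_addC retract_add0 retract_addN.

End Retract.

Inductive hterm (G : Type) : Type :=
| hgen of G
| hop of hterm G & hterm G & hterm G.

HB.instance Definition _ (G : Type) := gen_eqMixin (hterm G).
HB.instance Definition _ (G : Type) := gen_choiceMixin (hterm G).

Inductive hterm_cong (G : Type) : hterm G -> hterm G -> Prop :=
| hterm_refl s : hterm_cong s s
| hterm_sym s t : hterm_cong s t -> hterm_cong t s
| hterm_trans s t u : hterm_cong s t -> hterm_cong t u -> hterm_cong s u
| hterm_op s s' t t' u u' :
    hterm_cong s s' -> hterm_cong t t' -> hterm_cong u u' ->
    hterm_cong (hop s t u) (hop s' t' u')
| hterm_Kl s t : hterm_cong (hop s s t) t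
| hterm_Kr s t : hterm_cong (hop t s s) t
| hterm_A s t s' t' u' :
    hterm_cong (hop s t (hop s' t' u')) (hop (hop s t s') t' u')
| hterm_C s t u : hterm_cong (hop s t u) (hop u t s).

Section FreeAbHeap.
Variable G : Type.

Definition hterm_equiv (s t : hterm G) : bool := `[< hterm_cong s t >].

Fact hterm_equiv_refl : reflexive hterm_equiv.
Proof. by move=> s; apply/asboolP; exact: hterm_refl. Qed.

Fact hterm_equiv_sym : symmetric hterm_equiv.
Proof. by move=> s t; apply/asboolP/asboolP; exact: hterm_sym. Qed.

Fact hterm_equiv_trans : transitive hterm_equiv.
Proof.
by move=> t s u /asboolP st /asboolP tu; apply/asboolP/(hterm_trans st tu).
Qed.

Canonical hterm_equiv_rel :=
  EquivRel hterm_equiv hterm_equiv_refl hterm_equiv_sym hterm_equiv_trans.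

Definition freeAbHeap : Type := {eq_quot hterm_equiv}.

HB.instance Definition _ := Choice.on freeAbHeap.
HB.instance Definition _ := EqQuotient.on freeAbHeap.

Fact pi_htermP (s t : hterm G) :
  hterm_cong s t <-> \pi_freeAbHeap s = \pi_freeAbHeap t.
Proof. by split=> [st|/eqmodP/asboolP//]; apply/eqmodP/asboolP. Qed.

Definition freeAbHeap_gen (g : G) : freeAbHeap := \pi_freeAbHeap (hgen g).

Definition freeAbHeap_op (x y z : freeAbHeap) : freeAbHeap :=
  \pi_freeAbHeap (hop (repr x) (repr y) (repr z)).

Fact pi_hop (s t u : hterm G) :
  freeAbHeap_op (\pi s) (\pi t) (\pi u) = \pi_freeAbHeap (hop s t u).
Proof. by apply/pi_htermP/hterm_op; apply/pi_htermP; rewrite reprK. Qed.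

Fact freeAbHeap_Kl x y : freeAbHeap_op x x y = y.
Proof.
by elim/quotW: x y => s; elim/quotW => t; rewrite pi_hop; apply/pi_htermP/hterm_Kl.
Qed.

Fact freeAbHeap_Kr x y : freeAbHeap_op y x x = y.
Proof.
by elim/quotW: x y => s; elim/quotW => t; rewrite pi_hop; apply/pi_htermP/hterm_Kr.
Qed.

Fact freeAbHeap_A x y x' y' z' :
  freeAbHeap_op x y (freeAbHeap_op x' y' z') =
  freeAbHeap_op (freeAbHeap_op x y x') y' z'.
Proof.
elim/quotW: x => s; elim/quotW: y => t; elim/quotW: x' => s'.
elim/quotW: y' => t'; elim/quotW: z' => u'.
by rewrite !pi_hop; apply/pi_htermP/hterm_A.
Qed.

Fact freeAbHeap_C x y z : freeAbHeap_op x y z = freeAbHeap_op z y x.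
Proof.
elim/quotW: x => s; elim/quotW: y => t; elim/quotW: z => u.
by rewrite !pi_hop; apply/pi_htermP/hterm_C.
Qed.

HB.instance Definition _ :=
  isHeap.Build freeAbHeap freeAbHeap_Kl freeAbHeap_Kr freeAbHeap_A.
HB.instance Definition _ := Heap_isAbelian.Build freeAbHeap freeAbHeap_C.

End FreeAbHeap.

Inductive heap_cong (H : abHeapType) (R : H -> H -> Prop) : H -> H -> Prop :=
| heap_cong_gen x y : R x y -> heap_cong R x y
| heap_cong_refl x : heap_cong R x x
| heap_cong_sym x y : heap_cong R x y -> heap_cong R y x
| heap_cong_trans x y z :
    heap_cong R x y -> heap_cong R y z -> heap_cong R x z
| heap_cong_br x x' y y' z z' :
    heap_cong R x x' -> heap_cong R y y' -> heap_cong R z z' ->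
    heap_cong R (hbr x y z) (hbr x' y' z').

Section HeapQuotient.
Variables (H : abHeapType) (R : H -> H -> Prop).

Definition heap_equiv (x y : H) : bool := `[< heap_cong R x y >].

Fact heap_equiv_refl : reflexive heap_equiv.
Proof. by move=> x; apply/asboolP; exact: heap_cong_refl. Qed.

Fact heap_equiv_sym : symmetric heap_equiv.
Proof. by move=> x y; apply/asboolP/asboolP; exact: heap_cong_sym. Qed.

Fact heap_equiv_trans : transitive heap_equiv.
Proof.
by move=> y x z /asboolP xy /asboolP yz; apply/asboolP/(heap_cong_trans xy yz).
Qed.

Canonical heap_equiv_rel :=
  EquivRel heap_equiv heap_equiv_refl heap_equiv_sym heap_equiv_trans.

Definition heapQuot : Type := {eq_quot heap_equiv}.

HB.instance Definition _ := Choice.on heapQuot.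
HB.instance Definition _ := EqQuotient.on heapQuot.

Fact pi_heapQuotP (x y : H) :
  heap_cong R x y <-> \pi_heapQuot x = \pi_heapQuot y.
Proof. by split=> [xy|/eqmodP/asboolP//]; apply/eqmodP/asboolP. Qed.

Definition heapQuot_br (x y z : heapQuot) : heapQuot :=
  \pi_heapQuot (hbr (repr x) (repr y) (repr z)).

Fact pi_hbr (x y z : H) :
  heapQuot_br (\pi x) (\pi y) (\pi z) = \pi_heapQuot (hbr x y z).
Proof. by apply/pi_heapQuotP/heap_cong_br; apply/pi_heapQuotP; rewrite reprK. Qed.

Fact heapQuot_Kl x y : heapQuot_br x x y = y.
Proof. by elim/quotW: x y => x; elim/quotW => y; rewrite pi_hbr hbrKl. Qed.

Fact heapQuot_Kr x y : heapQuot_br y x x = y.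
Proof. by elim/quotW: x y => x; elim/quotW => y; rewrite pi_hbr hbrKr. Qed.

Fact heapQuot_A x y x' y' z' :
  heapQuot_br x y (heapQuot_br x' y' z') =
  heapQuot_br (heapQuot_br x y x') y' z'.
Proof.
elim/quotW: x => x; elim/quotW: y => y; elim/quotW: x' => x'.
by elim/quotW: y' => y'; elim/quotW: z' => z'; rewrite !pi_hbr hbrA.
Qed.

Fact heapQuot_C x y z : heapQuot_br x y z = heapQuot_br z y x.
Proof.
elim/quotW: x => x; elim/quotW: y => y; elim/quotW: z => z.
by rewrite !pi_hbr hbrC.
Qed.

HB.instance Definition _ :=
  isHeap.Build heapQuot heapQuot_Kl heapQuot_Kr heapQuot_A.
HB.instance Definition _ := Heap_isAbelian.Build heapQuot heapQuot_C.

End HeapQuotient.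

Inductive in_subgroup (V : zmodType) (A : V -> Prop) : V -> Prop :=
| in_subgroup_gen x : A x -> in_subgroup A x
| in_subgroup0 : in_subgroup A 0
| in_subgroupB x y : in_subgroup A x -> in_subgroup A y -> in_subgroup A (x - y).

Section ZmodQuotient.
Variables (V : zmodType) (A : V -> Prop).

Definition subgroup_gen : {pred V} := fun x => `[< in_subgroup A x >].

Fact subgroup_gen_zmod_closed : zmod_closed subgroup_gen.
Proof.
split=> [|x y /asboolP Ax /asboolP Ay]; apply/asboolP.
  exact: in_subgroup0.
exact: in_subgroupB.
Qed.

HB.instance Definition _ :=
  GRing.isZmodClosed.Build V subgroup_gen subgroup_gen_zmod_closed.

Definition zmodQuot : zmodType := Quotient.quot subgroup_gen.

Definition zmodQuot_pi (x : V) : zmodQuot := \pi_(Quotient.quot subgroup_gen) x.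

End ZmodQuotient.

Record category := Category {
  ob :> Type;
  mor : ob -> ob -> Type;
  idm : forall X, mor X X;
  mcomp : forall X Y Z, mor Y Z -> mor X Y -> mor X Z;
  mcomp1l : forall X Y (f : mor X Y), mcomp (idm Y) f = f;
  mcomp1r : forall X Y (f : mor X Y), mcomp f (idm X) = f;
  mcompA : forall X Y Z T (h : mor Z T) (g : mor Y Z) (f : mor X Y),
    mcomp h (mcomp g f) = mcomp (mcomp h g) f
}.

Notation "g \oc f" := (mcomp g f) (at level 40, left associativity).

Definition is_iso (C : category) (X Y : C) (f : mor X Y) : Prop :=
  exists g : mor Y X, g \oc f = idm X /\ f \oc g = idm Y.

Definition is_initial (C : category) (X : C) : Prop :=
  forall Y : C, exists! f : mor X Y, True.

Definition is_terminal (C : category) (X : C) : Prop :=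
  forall Y : C, exists! f : mor Y X, True.

(* The square with sides [f : Y -> X], [g : Y -> Z], [i : X -> P] and
   [j : Z -> P] is a pushout, i.e. P = X \sqcup_Y Z. *)
Definition is_pushout (C : category) (Y X Z P : C)
    (f : mor Y X) (g : mor Y Z) (i : mor X P) (j : mor Z P) : Prop :=
  i \oc f = j \oc g /\
  forall (Q : C) (u : mor X Q) (v : mor Z Q), u \oc f = v \oc g ->
    exists! h : mor P Q, h \oc i = u /\ h \oc j = v.

(* Pushouts are not chosen: the axioms bear on all pushout squares.  The
   identities are cofibrations by [cof_iso], and the [p] of [weq_gluing] is
   the induced morphism, unique by the universal property of [P]. *)
Record unpointedWaldhausen := UnpointedWaldhausen {
  uw_cat :> category;
  cof : forall X Y : uw_cat, mor X Y -> Prop;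
  weq : forall X Y : uw_cat, mor X Y -> Prop;
  cof_comp : forall (X Y Z : uw_cat) (g : mor Y Z) (f : mor X Y),
    cof g -> cof f -> cof (g \oc f);
  cof_iso : forall (X Y : uw_cat) (f : mor X Y), is_iso f -> cof f;
  cof_pushout_ex : forall (Y X Z : uw_cat) (f : mor Y X) (c : mor Y Z),
    cof c ->
    exists (P : uw_cat) (i : mor X P) (j : mor Z P), is_pushout f c i j;
  cof_pushout : forall (Y X Z P : uw_cat)
      (f : mor Y X) (c : mor Y Z) (i : mor X P) (j : mor Z P),
    cof c -> is_pushout f c i j -> cof i;
  weq_iso : forall (X Y : uw_cat) (f : mor X Y), is_iso f -> weq f;
  weq_comp : forall (X Y Z : uw_cat) (g : mor Y Z) (f : mor X Y),
    weq g -> weq f -> weq (g \oc f);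
  weq_gluing : forall (Y X Z P Y' X' Z' P' : uw_cat)
      (f : mor Y X) (c : mor Y Z) (i : mor X P) (j : mor Z P)
      (f' : mor Y' X') (c' : mor Y' Z') (i' : mor X' P') (j' : mor Z' P')
      (h : mor X X') (w : mor Y Y') (s : mor Z Z') (p : mor P P'),
    cof c -> cof c' -> weq h -> weq w -> weq s ->
    h \oc f = f' \oc w -> s \oc c = c' \oc w ->
    is_pushout f c i j -> is_pushout f' c' i' j' ->
    p \oc i = i' \oc h -> p \oc j = j' \oc s ->
    weq p
}.

Record waldhausen := Waldhausen {
  w_uw :> unpointedWaldhausen;
  wzero : w_uw;
  wzero_initial : is_initial wzero;
  wzero_terminal : is_terminal wzero;
  wzero_cof : forall (X : w_uw) (f : mor wzero X), cof f
}.

Definition weq_equiv (C : unpointedWaldhausen) : C -> C -> Prop :=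
  clos_refl_sym_trans C (fun X Y => exists f : mor X Y, weq f).

(* A set of weak equivalence classes: the universe of [wcls_sort] is
   independent of that of the objects of [C], so that providing such a
   structure is the assumption that the classes of the possibly large
   category [C] form a set.  [wcls X] is the class of [X]. *)
Record weqClasses (C : unpointedWaldhausen) := WeqClasses {
  wcls_sort :> choiceType;
  wcls : C -> wcls_sort;
  wcls_surj : forall a, exists X, wcls X = a;
  wclsP : forall X Y, wcls X = wcls Y <-> weq_equiv X Y
}.

Section GrothendieckHeap.
Variables (C : unpointedWaldhausen) (S : weqClasses C).

Local Notation gen X := (freeAbHeap_gen (wcls S X)).

Inductive K0_rel : freeAbHeap S -> freeAbHeap S -> Prop :=
| K0_rel_pushout (Y X Z P : C)
    (f : mor Y X) (g : mor Y Z) (i : mor X P) (j : mor Z P) :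
    cof g \/ cof f -> is_pushout f g i j ->
    K0_rel (hbr (gen X) (gen Y) (gen Z)) (gen P).

Definition K0 : abHeapType := heapQuot K0_rel.

Definition K0_cls (X : C) : K0 := \pi_(heapQuot K0_rel) (gen X).

End GrothendieckHeap.

Section ClassicalGrothendieckGroup.
Variables (C : waldhausen) (S : weqClasses C).

Local Notation gen X := (<< wcls S X >> : {freeg S}).

(* The defining relations, as the elements of the free abelian group to be
   killed: X + Y/X - Y for each cofiber sequence X >-> Y -> Y/X. *)
Inductive K0c_rel : {freeg S} -> Prop :=
| K0c_rel_cofiber (X Y Q : C)
    (c : mor X Y) (z : mor X (wzero C)) (i : mor (wzero C) Q) (q : mor Y Q) :
    cof c -> is_pushout z c i q ->
    K0c_rel (gen X + gen Q - gen Y).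

Definition K0c : zmodType := zmodQuot K0c_rel.

Definition K0c_cls (X : C) : K0c := zmodQuot_pi K0c_rel (gen X).

End ClassicalGrothendieckGroup.

(* Main.v *)
(** Both sides are given by generators and relations on the same generators, so
    each of the two maps only has to be checked on relations.  A cofiber
    sequence X >-> Y -> Q is a pushout of 0 <- X >-> Y, hence gives
    [0, X, Y] = Q in the heap, i.e. Q = Y - X in the retract.  Conversely, for a
    pushout P of X <- Y >-> Z, pasting pushout squares shows that X >-> P has the
    same cofiber Q as Y >-> Z, so that X - Y + Z = X + Q = P in the classical
    group. *)
From HB Require Import structures.
Require Import Defs.
From mathcomp Require Import all_boot all_algebra.
From mathcomp.classical Require Import boolp.
From mathcomp.multinomials Require Import freeg.

Set Implicit Arguments.
Unset Strict Implicit.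
Unset Printing Implicit Defensive.

Import GRing.Theory.
Local Open Scope ring_scope.
Local Open Scope quotient_scope.

(** * Heap morphisms, and the passage between abelian groups and abelian heaps *)

Definition heap_morph (H H' : abHeapType) (f : H -> H') : Prop :=
  forall x y z, f (hbr x y z) = hbr (f x) (f y) (f z).

(** An alias that carries the bracket [x - y + z], so that universal properties of heaps can be used
    with an abelian group as target. *)
Definition zheap (V : Type) : Type := V.

Section ZHeap.
Variable V : zmodType.

Definition zheap_br (x y z : V) : V := x - y + z.

Fact zheap_Kl x y : zheap_br x x y = y.
Proof. by rewrite /zheap_br subrr add0r. Qed.

Fact zheap_Kr x y : zheap_br y x x = y.
Proof. exact: subrK. Qed.

Fact zheap_A x y x' y' z' :
  zheap_br x y (zheap_br x' y' z') = zheap_br (zheap_br x y x') y' z'.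
Proof. by rewrite /zheap_br !addrA. Qed.

Fact zheap_C x y z : zheap_br x y z = zheap_br z y x.
Proof. by rewrite /zheap_br addrAC [x + z]addrC addrAC. Qed.

HB.instance Definition _ := Choice.copy (zheap V) V.
HB.instance Definition _ :=
  isHeap.Build (zheap V) zheap_Kl zheap_Kr zheap_A.
HB.instance Definition _ := Heap_isAbelian.Build (zheap V) zheap_C.

Lemma zheap_brE (x y z : zheap V) : hbr x y z = (x : V) - y + z.
Proof. by []. Qed.

End ZHeap.

(** Passing to the retract loses nothing: unfolding its operations gives [[x, e, [e, y, e]], e, z],
    where every [e] cancels by associativity and the two unit laws. *)
Lemma retract_brE (H : abHeapType) (e : H) (x y z : retract e) :
  hbr (x : H) y z = x - y + z :> retract e.
Proof.
change (hbr (x : H) y z = hbr (hbr (x : H) e (hbr e y e)) e z).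
by rewrite !hbrA hbrKr -hbrA hbrKl.
Qed.

(** Subtraction in the retract is the bracket [x, y, e], because [e] is its zero; a heap morphism
    sending [e] to 0 therefore preserves it. *)
Lemma retract_additive (H : abHeapType) (V : zmodType) (e : H)
    (f : H -> zheap V) :
  heap_morph f -> f e = (0 : V) ->
  {morph (f : retract e -> V) : x y / x - y}.
Proof.
move=> fM fe x y; have -> : x - y = hbr (x : H) y e.
  by rewrite -[LHS]addr0 -retract_brE.
by rewrite fM fe zheap_brE addr0.
Qed.

(** * Universal property of free abelian heaps *)

Section FreeAbHeapTheory.
Variables (G : Type) (H : abHeapType) (phi : G -> H).

Fixpoint hterm_eval (s : hterm G) : H :=
  match s with
  | hgen g => phi g
  | hop s t u => hbr (hterm_eval s) (hterm_eval t) (hterm_eval u)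
  end.

Lemma hterm_eval_cong s t : hterm_cong s t -> hterm_eval s = hterm_eval t.
Proof.
elim=> //= {s t}.
- by move=> s t u _ -> _ ->.
- by move=> s s' t t' u u' _ -> _ -> _ ->.
- by move=> s t; rewrite hbrKl.
- by move=> s t; rewrite hbrKr.
- by move=> s t s' t' u'; rewrite hbrA.
- by move=> s t u; rewrite hbrC.
Qed.

(** Evaluates a chosen term for [x]; the choice is harmless because evaluation in an abelian heap
    respects [hterm_cong]. *)
Definition freeAbHeap_lift (x : freeAbHeap G) : H := hterm_eval (repr x).

Lemma freeAbHeap_lift_pi s :
  freeAbHeap_lift (\pi_(freeAbHeap G) s) = hterm_eval s.
Proof. by apply/hterm_eval_cong/pi_htermP; rewrite reprK. Qed.

Lemma freeAbHeap_lift_gen g : freeAbHeap_lift (freeAbHeap_gen g) = phi g.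
Proof. exact: freeAbHeap_lift_pi. Qed.

Lemma freeAbHeap_lift_morph : heap_morph freeAbHeap_lift.
Proof. by move=> x y z; rewrite freeAbHeap_lift_pi. Qed.

End FreeAbHeapTheory.

Lemma freeAbHeap_ind (G : Type) (P : freeAbHeap G -> Prop) :
  (forall g, P (freeAbHeap_gen g)) ->
  (forall x y z, P x -> P y -> P z -> P (hbr x y z)) -> forall x, P x.
Proof.
move=> Pgen Pbr; elim/quotW; elim=> [g|s Ps t Pt u Pu]; first exact: Pgen.
by rewrite -pi_hop; exact: Pbr.
Qed.

(** * Universal property of quotient heaps *)

Section HeapQuotientTheory.
Variables (H : abHeapType) (R : H -> H -> Prop).

Lemma pi_heapQuot_morph : heap_morph (\pi_(heapQuot R)).
Proof. by move=> x y z; rewrite -pi_hbr. Qed.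

Variables (H' : abHeapType) (f : H -> H').
Hypotheses (fM : heap_morph f) (fR : forall x y, R x y -> f x = f y).

Lemma heap_cong_morph x y : heap_cong R x y -> f x = f y.
Proof.
elim=> {x y} // [x y z _ -> _ -> //|x x' y y' z z' _ fx _ fy _ fz].
by rewrite !fM fx fy fz.
Qed.

Definition heapQuot_lift (x : heapQuot R) : H' := f (repr x).

Lemma heapQuot_lift_pi x : heapQuot_lift (\pi_(heapQuot R) x) = f x.
Proof. by apply/heap_cong_morph/pi_heapQuotP; rewrite reprK. Qed.

Lemma heapQuot_lift_morph : heap_morph heapQuot_lift.
Proof. by move=> x y z; rewrite heapQuot_lift_pi fM. Qed.

End HeapQuotientTheory.

(** * Universal property of quotients of abelian groups *)

Section ZmodQuotientTheory.
Variables (V : zmodType) (A : V -> Prop).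

Lemma zmodQuot_piB : {morph zmodQuot_pi A : x y / x - y}.
Proof. by move=> x y; rewrite /zmodQuot_pi !piE. Qed.

HB.instance Definition _ :=
  GRing.isZmodMorphism.Build V (zmodQuot A) (zmodQuot_pi A) zmodQuot_piB.

Lemma zmodQuot_piK (x : zmodQuot A) : zmodQuot_pi A (repr x) = x.
Proof. exact: reprK. Qed.

Lemma zmodQuot_pi_eqP x y :
  zmodQuot_pi A x = zmodQuot_pi A y <-> in_subgroup A (x - y).
Proof.
split=> [/eqP|Axy]; first by rewrite -Quotient.idealrBE => /asboolP.
by apply/eqP; rewrite -Quotient.idealrBE; apply/asboolP.
Qed.

Lemma zmodQuot_pi_gen x : A x -> zmodQuot_pi A x = 0.
Proof.
move=> Ax; rewrite -(raddf0 (zmodQuot_pi A)).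
by apply/zmodQuot_pi_eqP; rewrite subr0; exact: in_subgroup_gen.
Qed.

Variables (W : zmodType) (f : {additive V -> W}).
Hypothesis fA : forall x, A x -> f x = 0.

Definition zmodQuot_lift (x : zmodQuot A) : W := f (repr x).

Lemma in_subgroup_ker x : in_subgroup A x -> f x = 0.
Proof.
by elim=> [||y z _ fy _ fz]; [exact: fA|exact: raddf0|rewrite raddfB fy fz subr0].
Qed.

(** The chosen representative of the class of [x] differs from [x] by an element of the generated
    subgroup, which [f] kills. *)
Lemma zmodQuot_lift_pi x : zmodQuot_lift (zmodQuot_pi A x) = f x.
Proof.
apply/eqP; rewrite -subr_eq0 -raddfB; apply/eqP/in_subgroup_ker.
by apply/zmodQuot_pi_eqP; rewrite zmodQuot_piK.
Qed.

Lemma zmodQuot_liftB : {morph zmodQuot_lift : x y / x - y}.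
Proof.
move=> x y; rewrite -[in LHS](zmodQuot_piK x) -[in LHS](zmodQuot_piK y).
by rewrite -raddfB zmodQuot_lift_pi raddfB.
Qed.

End ZmodQuotientTheory.

(** * Free abelian groups: induction and universal property *)

Lemma freeg_zmod_ind (K : choiceType) (P : {freeg K} -> Prop) :
  (forall k, P << k >>) -> P 0 -> (forall x y, P x -> P y -> P (x - y)) ->
  forall x, P x.
Proof.
move=> Pgen P0 PB.
have PN x : P x -> P (- x) by rewrite -sub0r; exact: PB.
have PD x y : P x -> P y -> P (x + y).
  by move=> Px Py; rewrite -[y]opprK; apply/PB/PN.
have PMn x n : P x -> P (x *+ n).
  by move=> Px; elim: n => // n IHn; rewrite mulrS; exact: PD.
(* Expand [x] as a finite sum of integer multiples of generators; the sign of each coefficient then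
   decides between [PMn] alone and [PN] after [PMn]. *)
move=> x; rewrite -(freeg_sumE x); elim/big_rec: _ => // k y _ Py; apply: PD => //.
rewrite -[coeff k x]intz -freegU_mulz.
by case: (coeff k x) => n; [exact: PMn|rewrite NegzE mulrNz; apply/PN/PMn].
Qed.

Section FreegLift.
Variables (K : choiceType) (V : zmodType) (phi : K -> V).

Definition freeg_lift : {freeg K} -> V := fglift (phi : K -> zmodule V).

Lemma freeg_lift_gen k : freeg_lift << k >> = phi k.
Proof. by rewrite /freeg_lift liftU scale1r. Qed.

Lemma freeg_liftB : {morph freeg_lift : x y / x - y}.
Proof. exact: (lift_is_additive (phi : K -> zmodule V)). Qed.

HB.instance Definition _ :=
  GRing.isZmodMorphism.Build {freeg K} V freeg_lift freeg_liftB.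

End FreegLift.

(** * Pasting of pushout squares *)

Section Pushouts.
Variable C : category.

Lemma is_pushout_sym (Y X Z P : C)
    (f : mor Y X) (g : mor Y Z) (i : mor X P) (j : mor Z P) :
  is_pushout f g i j -> is_pushout g f j i.
Proof.
move=> [fg univ]; split=> // Q u v uv.
have [h [[hi hj] h_uniq]] := univ Q v u (esym uv).
by exists h; split=> // h' [h'j h'i]; exact: h_uniq.
Qed.

Lemma is_pushout_idm (X Y : C) (f : mor X Y) :
  is_pushout f (idm X) (idm Y) f.
Proof.
split=> [|Q u v]; first by rewrite mcomp1l mcomp1r.
rewrite mcomp1r => <-; exists u; split; first by rewrite mcomp1r.
by move=> h [<- _]; rewrite mcomp1r.
Qed.

(** Pasting law: when the first square and the outer rectangle are pushouts, so is the second
    square. The map [k] is induced out of [P] by [a \oc h] and [q]. *)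
Lemma is_pushout_cancel (Y X Z P W Q : C)
    (f : mor Y X) (g : mor Y Z) (i : mor X P) (j : mor Z P)
    (h : mor X W) (a : mor W Q) (q : mor Z Q) :
  is_pushout f g i j -> is_pushout (h \oc f) g a q ->
  exists k : mor P Q, is_pushout h i a k.
Proof.
move=> [fg univP] [hfg univQ].
have [|k [[ki kj] k_uniq]] := univP Q (a \oc h) q; first by rewrite -mcompA.
exists k; split=> [//|T u v uv].
have [|m [[ma mq] m_uniq]] := univQ T u (v \oc j).
  by rewrite mcompA uv -mcompA fg mcompA.
(* Uniqueness out of [P] will identify [m \oc k] with [v]: both restrict to [v \oc i] and
   [v \oc j]. *)
have [|n [_ n_uniq]] := univP T (v \oc i) (v \oc j).
  by rewrite -!mcompA fg.
exists m; split=> [|m' [m'a m'k]].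
  split=> //; rewrite -(n_uniq (m \oc k)); first by apply: n_uniq.
  by rewrite -!mcompA ki kj mcompA ma uv.
by apply: m_uniq; split=> //; rewrite -kj mcompA m'k.
Qed.

End Pushouts.

(** * The two comparison maps and their composites *)

Section Comparison.
Variables (C : waldhausen) (S : weqClasses C).

Lemma K0_cls_pushout (Y X Z P : C)
    (f : mor Y X) (g : mor Y Z) (i : mor X P) (j : mor Z P) :
  cof g \/ cof f -> is_pushout f g i j ->
  hbr (K0_cls S X) (K0_cls S Y) (K0_cls S Z) = K0_cls S P.
Proof.
move=> cfg pfg; rewrite /K0_cls -pi_heapQuot_morph; apply/pi_heapQuotP.
exact/heap_cong_gen/(K0_rel_pushout S cfg pfg).
Qed.

Lemma K0c_cls_cofiber (X Y Q : C)
    (c : mor X Y) (z : mor X (wzero C)) (i : mor (wzero C) Q) (q : mor Y Q) :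
  cof c -> is_pushout z c i q ->
  K0c_cls S X + K0c_cls S Q = K0c_cls S Y.
Proof.
move=> cc zc; apply/eqP; rewrite -subr_eq0 /K0c_cls -raddfD -raddfB; apply/eqP.
exact/zmodQuot_pi_gen/(K0c_rel_cofiber S cc zc).
Qed.

(** The identity square on the zero object is a cofiber sequence, so the class of 0 added to itself
    is itself. *)
Lemma K0c_cls0 : K0c_cls S (wzero C) = 0.
Proof.
apply: (addIr (K0c_cls S (wzero C))); rewrite add0r.
exact: K0c_cls_cofiber (wzero_cof _) (is_pushout_idm (idm _)).
Qed.

Lemma K0c_cls_cof_pushout (Y X Z P : C)
    (f : mor Y X) (c : mor Y Z) (i : mor X P) (j : mor Z P) :
  cof c -> is_pushout f c i j ->
  K0c_cls S X - K0c_cls S Y + K0c_cls S Z = K0c_cls S P.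
Proof.
move=> cc fc; have [z _] := wzero_terminal X.
(* [Q] is Z/Y; by the pasting law it is also P/X. *)
have [Q [a [q zfc]]] := cof_pushout_ex (z \oc f) cc.
have [k zi] := is_pushout_cancel fc zfc.
rewrite -(K0c_cls_cofiber cc zfc) -(K0c_cls_cofiber (cof_pushout cc fc) zi).
by rewrite addrA subrK.
Qed.

Lemma K0c_cls_pushout (Y X Z P : C)
    (f : mor Y X) (g : mor Y Z) (i : mor X P) (j : mor Z P) :
  cof g \/ cof f -> is_pushout f g i j ->
  K0c_cls S X - K0c_cls S Y + K0c_cls S Z = K0c_cls S P.
Proof.
case=> [cg|cf] fg; first exact: K0c_cls_cof_pushout cg fg.
(* Transposing the square exchanges [X] and [Z], which x - y + z allows. *)
rewrite -(K0c_cls_cof_pushout cf (is_pushout_sym fg)); exact: zheap_C.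
Qed.

Definition K0_to_K0c_free : freeAbHeap S -> zheap (K0c S) :=
  freeAbHeap_lift (fun s => zmodQuot_pi _ << s >> : zheap (K0c S)).

Lemma K0_to_K0c_free_rel x y :
  @K0_rel C S x y -> K0_to_K0c_free x = K0_to_K0c_free y.
Proof.
case=> Y X Z P f g i j cfg fg.
rewrite /K0_to_K0c_free freeAbHeap_lift_morph !freeAbHeap_lift_gen.
exact: K0c_cls_pushout cfg fg.
Qed.

Definition K0_to_K0c_heap : K0 S -> zheap (K0c S) :=
  heapQuot_lift K0_to_K0c_free.

Lemma K0_to_K0c_heap_morph : heap_morph K0_to_K0c_heap.
Proof.
exact: heapQuot_lift_morph (freeAbHeap_lift_morph _) K0_to_K0c_free_rel.
Qed.

Local Notation K0r := (retract (K0_cls S (wzero C))).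

Definition K0_to_K0c : K0r -> K0c S := K0_to_K0c_heap.

Lemma K0_to_K0c_cls X : K0_to_K0c (K0_cls S X) = K0c_cls S X.
Proof.
rewrite /K0_to_K0c /K0_to_K0c_heap.
rewrite (heapQuot_lift_pi (freeAbHeap_lift_morph _) K0_to_K0c_free_rel).
by rewrite /K0_to_K0c_free freeAbHeap_lift_gen.
Qed.

Lemma K0_to_K0cB : {morph K0_to_K0c : x y / x - y}.
Proof.
apply: retract_additive K0_to_K0c_heap_morph _.
by rewrite [LHS]K0_to_K0c_cls K0c_cls0.
Qed.

HB.instance Definition _ :=
  GRing.isZmodMorphism.Build K0r (K0c S) K0_to_K0c K0_to_K0cB.

(** Defined on weak equivalence classes rather than on objects, so no representing object has to be
    chosen. *)
Definition K0c_to_K0_free : {freeg S} -> K0r :=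
  freeg_lift (fun s => \pi_(heapQuot (@K0_rel C S)) (freeAbHeap_gen s) : K0r).

HB.instance Definition _ := GRing.Additive.on K0c_to_K0_free.

Lemma K0_cls_cofiber (X Y Q : C)
    (c : mor X Y) (z : mor X (wzero C)) (i : mor (wzero C) Q) (q : mor Y Q) :
  cof c -> is_pushout z c i q ->
  (K0_cls S X : K0r) + K0_cls S Q = K0_cls S Y.
Proof.
move=> cc zc; rewrite -(K0_cls_pushout (or_introl cc) zc).
(* The zero of the retract is the class of the zero object, so [0, X, Y] reads 0 - X + Y. *)
by rewrite (retract_brE (0 : K0r)) sub0r addrA subrr add0r.
Qed.

Lemma K0c_to_K0_free_rel x : @K0c_rel C S x -> K0c_to_K0_free x = 0.
Proof.
case=> X Y Q c z i q cc zc.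
rewrite raddfB raddfD /= /K0c_to_K0_free !freeg_lift_gen.
by rewrite [W in W - _](K0_cls_cofiber cc zc) subrr.
Qed.

Definition K0c_to_K0 : K0c S -> K0r := zmodQuot_lift K0c_to_K0_free.

Lemma K0c_to_K0B : {morph K0c_to_K0 : x y / x - y}.
Proof. exact: zmodQuot_liftB K0c_to_K0_free_rel. Qed.

HB.instance Definition _ :=
  GRing.isZmodMorphism.Build (K0c S) K0r K0c_to_K0 K0c_to_K0B.

Lemma K0c_to_K0_cls X : K0c_to_K0 (K0c_cls S X) = K0_cls S X.
Proof.
rewrite /K0c_to_K0 (zmodQuot_lift_pi K0c_to_K0_free_rel).
by rewrite /= /K0c_to_K0_free freeg_lift_gen.
Qed.

Lemma K0_to_K0cK : cancel K0_to_K0c K0c_to_K0.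
Proof.
elim/quotW; elim/freeAbHeap_ind => [s|x y z Hx Hy Hz].
  (* Every generator is the class of some object, where both maps are known. *)
  by have [X <-] := wcls_surj s; rewrite K0_to_K0c_cls K0c_to_K0_cls.
(* Brackets become x - y + z in the retract, which both additive maps preserve. *)
rewrite pi_heapQuot_morph (@retract_brE _ (K0_cls S (wzero C))).
by rewrite !(raddfD, raddfN) /= Hx Hy Hz.
Qed.

Lemma K0c_to_K0K : cancel K0c_to_K0 K0_to_K0c.
Proof.
move=> x; rewrite -(zmodQuot_piK x).
elim/freeg_zmod_ind: (repr x) => [s||y z Hy Hz].
- by have [X <-] := wcls_surj s; rewrite K0c_to_K0_cls K0_to_K0c_cls.
- by rewrite !raddf0.
- by rewrite !raddfB /= Hy Hz.
Qed.

End Comparison.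

Theorem theorem2p5 (C : waldhausen) (S : weqClasses C) :
  exists f : {additive retract (K0_cls S (wzero C)) -> K0c S},
    bijective f /\ forall X : C, f (K0_cls S X) = K0c_cls S X.
Proof.
exists (K0_to_K0c (S := S) : {additive _ -> _}); split.
  exact: Bijective (@K0_to_K0cK C S) (@K0c_to_K0K C S).
exact: K0_to_K0c_cls.
Qed.
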